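(* Suppose $P,Q$ are real symmetric matrices of the same size such that both $P$ and $P+Q$ are positive semi-definite. Then \[ \left\|\sqrt{P+Q}-\sqrt P\right\|\le 3\sqrt{\|Q\|}. \]
   Context: $\|\cdot\|$ denotes the operator (spectral) norm of a matrix, and $\sqrt{M}$ denotes the unique positive semi-definite square root of a positive semi-definite matrix $M$. *)

(* Defs.v *)
From HB Require Import structures.
From mathcomp Require Import all_boot all_order all_algebra.
From mathcomp Require Import all_classical all_reals.

Set Implicit Arguments.
Unset Strict Implicit.
Unset Printing Implicit Defensive.

Import Order.TTheory GRing.Theory Num.Theory.

Local Open Scope classical_set_scope.
Local Open Scope ring_scope.

Definition l2norm (R : realType) (n : nat) (u : 'cV[R]_n) : R :=
  Num.sqrt (\sum_i u i 0 ^+ 2).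

(* The set is bounded and contains 0, so the junk value of [sup] never occurs;
   for n = 0 this gives 0. *)
Definition opnorm (R : realType) (m n : nat) (A : 'M[R]_(m, n)) : R :=
  sup [set l2norm (A *m u) | u in [set u : 'cV[R]_n | l2norm u <= 1]].

Definition psdmx (R : realType) (n : nat) (M : 'M[R]_n) : Prop :=
  M \is symmetricmx /\ forall u : 'cV[R]_n, 0 <= (u^T *m M *m u) 0 0.

(* For psd M exactly one S satisfies the condition; the default 0 is only
   reached when M is not psd. *)
Definition sqrtmx (R : realType) (n : nat) (M : 'M[R]_n) : 'M[R]_n :=
  xget 0 [set S : 'M[R]_n | psdmx S /\ S *m S = M].

(* Main.v *)
Require Import Defs.
From HB Require Import structures.
From mathcomp Require Import all_boot all_order all_algebra.
From mathcomp Require Import all_classical all_reals.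
From mathcomp Require Import complex ring lra.

(** The theorem holds with constant 1 instead of 3.  Put [A = sqrt (P + Q)],
    [B = sqrt P] and [D = A - B], so that [Q = A^2 - B^2].
    The matrix [D] is symmetric, so its norm is governed by its eigenvalues.
    If [D u = a u] with [u] nonzero, then
    [<u, Q u> = |A u|^2 - |B u|^2 = <D u, (A + B) u>
    = a (<u, A u> + <u, B u>)], while
    [a |u|^2 = <u, D u> = <u, A u> - <u, B u>].  As [<u, A u>] and [<u, B u>]
    are nonnegative, their sum dominates the absolute value of their
    difference, hence [a^2 |u|^2 <= |<u, Q u>| <= |Q| |u|^2]; this is
    [sqr_eigenvalue_le_opnorm].

    Two facts about symmetric matrices remain: a psd matrix has a psd square
    root (otherwise [sqrtmx] would be a default value), and
    [|D u|^2 <= c^2 |u|^2] as soon as [a^2 <= c^2] for every eigenvalue [a].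
    Both follow from [symmx_poly_sqrt]: a polynomial [p] that is
    nonnegative on the eigenvalues of a symmetric [M] satisfies
    [p(M) = r(M)^2], where the polynomial [r] interpolates [sqrt p] on the
    eigenvalues.  Hence [p(M)] is psd; this is applied to [p = 'X] for the
    square root and to [p = c^2 - 'X^2] for the norm.  Replacing [sqrt p] by a
    polynomial keeps everything real and symmetric: complex numbers enter only
    in [symmx_spectrum], where the unitary diagonalization of [M] shows that a
    polynomial vanishing on the real eigenvalues of [M] annihilates [M]. *)

Set Implicit Arguments.
Unset Strict Implicit.
Unset Printing Implicit Defensive.

Import Order.TTheory GRing.Theory Num.Theory.

Local Open Scope classical_set_scope.
Local Open Scope ring_scope.

(** * The Euclidean inner product *)

Definition dot (R : realType) (n : nat) (u w : 'cV[R]_n) : R :=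
  (u^T *m w) 0 0.

Section Dot.
Variables (R : realType) (n : nat).
Implicit Types (u w : 'cV[R]_n) (M : 'M[R]_n).

Lemma dotE u w : dot u w = \sum_i u i 0 * w i 0.
Proof. by rewrite /dot mxE; apply: eq_bigr => i _; rewrite mxE. Qed.

Lemma dotC u w : dot u w = dot w u.
Proof. by rewrite !dotE; apply: eq_bigr => i _; rewrite mulrC. Qed.

Lemma dotDr u w1 w2 : dot u (w1 + w2) = dot u w1 + dot u w2.
Proof. by rewrite /dot mulmxDr mxE. Qed.

Lemma dotBr u w1 w2 : dot u (w1 - w2) = dot u w1 - dot u w2.
Proof. by rewrite /dot mulmxBr !mxE. Qed.

Lemma dotZr a u w : dot u (a *: w) = a * dot u w.
Proof. by rewrite /dot -scalemxAr mxE. Qed.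

Lemma dotZl a u w : dot (a *: u) w = a * dot u w.
Proof. by rewrite dotC dotZr dotC. Qed.

Lemma dotBl u1 u2 w : dot (u1 - u2) w = dot u1 w - dot u2 w.
Proof. by rewrite dotC dotBr !(dotC w). Qed.

Lemma dot_mull M u w : dot (M *m u) w = dot u (M^T *m w).
Proof. by rewrite /dot trmx_mul mulmxA. Qed.

Lemma dot_ge0 u : 0 <= dot u u.
Proof. by rewrite dotE sumr_ge0 // => i _; rewrite -expr2 sqr_ge0. Qed.

Lemma dot_gt0 u : u != 0 -> 0 < dot u u.
Proof.
move=> u_neq0; rewrite lt_neqAle dot_ge0 andbT eq_sym.
apply: contra_neq u_neq0; rewrite dotE => /eqP.
rewrite psumr_eq0; last by move=> i _; rewrite -expr2 sqr_ge0.
move=> /allP u0; apply/colP => i; rewrite mxE.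
by have := u0 i (mem_index_enum i); rewrite /= mulf_eq0 orbb => /eqP.
Qed.

(** With [a = <u, u>] and [b = <u, w>], the vector [a w - b u] is [a] times
    the component of [w] orthogonal to [u]; its squared norm is
    [a (a <w, w> - b^2)]. *)
Lemma dot_CauchySchwarz u w : dot u w ^+ 2 <= dot u u * dot w w.
Proof.
have [->|u_neq0] := eqVneq u 0.
  by rewrite /dot trmx0 !mul0mx mxE expr2 !mul0r.
have := dot_ge0 (dot u u *: w - dot u w *: u).
rewrite !(dotBl, dotBr, dotZl, dotZr) (dotC w u).
move: (dot u u) (dot u w) (dot w w) (dot_gt0 u_neq0) => a b c a_gt0.
rewrite -(subr_ge0 (b ^+ 2)) -(pmulr_rge0 _ a_gt0).
by congr (0 <= _); ring.
Qed.

Lemma l2normE u : l2norm u = Num.sqrt (dot u u).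
Proof. by rewrite /l2norm dotE. Qed.

Lemma sqr_l2norm u : l2norm u ^+ 2 = dot u u.
Proof. by rewrite l2normE sqr_sqrtr ?dot_ge0. Qed.

Lemma l2norm_ge0 u : 0 <= l2norm u.
Proof. by rewrite l2normE sqrtr_ge0. Qed.

Lemma l2normZ a u : l2norm (a *: u) = `|a| * l2norm u.
Proof.
rewrite !l2normE dotZl dotZr mulrA -expr2 sqrtrM ?sqr_ge0 //.
by rewrite sqrtr_sqr.
Qed.

Lemma normr_dot_le u w : `|dot u w| <= l2norm u * l2norm w.
Proof.
rewrite -(ler_pXn2r (n := 2)) ?nnegrE ?mulr_ge0 ?l2norm_ge0 //.
by rewrite real_normK ?num_real // exprMn !sqr_l2norm dot_CauchySchwarz.
Qed.

End Dot.

(** * The operator norm *)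

Section OpNorm.
Variables (R : realType) (n : nat).
Implicit Types (u w : 'cV[R]_n) (M : 'M[R]_n).

Lemma l2norm0 : l2norm (0 : 'cV[R]_n) = 0.
Proof. by rewrite l2normE /dot mulmx0 mxE sqrtr0. Qed.

Lemma opnorm_set_neq0 M :
  [set l2norm (M *m u) | u in [set u : 'cV[R]_n | l2norm u <= 1]] !=set0.
Proof. by exists (l2norm (M *m 0)); exists 0 => //=; rewrite l2norm0. Qed.

(** Entries of a vector of norm at most 1 are at most 1 in absolute value, so
    each entry of [M u] is at most the absolute sum of a row of [M]. *)
Lemma opnorm_has_sup M :
  has_sup [set l2norm (M *m u) | u in [set u : 'cV[R]_n | l2norm u <= 1]].
Proof.
split; first exact: opnorm_set_neq0.
exists (Num.sqrt (\sum_i (\sum_j `|M i j|) ^+ 2)) => _ [u /= u_le1 <-].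
rewrite ler_sqrt; last by rewrite sumr_ge0 // => i _; rewrite sqr_ge0.
apply: ler_sum => i _; rewrite -[leLHS]real_normK ?num_real //.
rewrite ler_pXn2r ?nnegrE ?sumr_ge0 // mxE.
apply: le_trans (ler_norm_sum _ _ _) _; apply: ler_sum => j _.
rewrite normrM ler_piMr // (le_trans _ u_le1) // -sqrtr_sqr ler_sqrt.
  rewrite (bigD1 j) //= lerDl sumr_ge0 // => k _; exact: sqr_ge0.
by rewrite sumr_ge0 // => k _; rewrite sqr_ge0.
Qed.

Lemma opnorm_ge0 M : 0 <= opnorm M.
Proof.
apply: (sup_upper_bound (opnorm_has_sup M)); exists 0 => /=.
  by rewrite l2norm0.
by rewrite mulmx0 l2norm0.
Qed.

Lemma l2norm_mul_le M u : l2norm (M *m u) <= opnorm M * l2norm u.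
Proof.
have [->|u_neq0] := eqVneq u 0; first by rewrite mulmx0 l2norm0 mulr0.
have u_gt0 : 0 < l2norm u by rewrite l2normE sqrtr_gt0 dot_gt0.
rewrite -ler_pdivrMr // mulrC -(gtr0_norm (x := (l2norm u)^-1)) ?invr_gt0 //.
rewrite -l2normZ scalemxAr; apply: (sup_upper_bound (opnorm_has_sup M)).
exists ((l2norm u)^-1 *: u) => //=.
by rewrite l2normZ gtr0_norm ?invr_gt0 // mulVf ?gt_eqF.
Qed.

Lemma opnorm_le M c : 0 <= c ->
  (forall u, dot (M *m u) (M *m u) <= c ^+ 2 * dot u u) -> opnorm M <= c.
Proof.
move=> c_ge0 Mc; apply: ge_sup (opnorm_set_neq0 M) _ => _ [u /= u_le1 <-].
rewrite -(ler_pXn2r (n := 2)) ?nnegrE ?l2norm_ge0 // sqr_l2norm.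
apply: le_trans (Mc u) _; rewrite ler_piMr ?sqr_ge0 // -sqr_l2norm.
by rewrite expr_le1 ?l2norm_ge0.
Qed.

Lemma normr_quadform_le M u : `|dot u (M *m u)| <= opnorm M * dot u u.
Proof.
apply: le_trans (normr_dot_le _ _) _; rewrite -sqr_l2norm expr2 mulrA mulrC.
by rewrite ler_wpM2r ?l2norm_ge0 ?l2norm_mul_le.
Qed.

End OpNorm.

(** * Polynomials in a symmetric matrix *)

Section Symmetric.
Variable R : realType.

Lemma symmxP n (M : 'M[R]_n) : reflect (M^T = M) (M \is symmetricmx).
Proof.
by apply: (iffP (is_hermitianmxP _ _ _)); rewrite expr0 scale1r map_mx_id.
Qed.

Lemma psdmx_dot n (M : 'M[R]_n) u : psdmx M -> 0 <= dot u (M *m u).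
Proof. by move=> [_ /(_ u)]; rewrite /dot mulmxA. Qed.

Lemma psdmx_sqr n (M : 'M[R]_n) : M \is symmetricmx -> psdmx (M *m M).
Proof.
move=> /symmxP Msym; split; first by apply/symmxP; rewrite trmx_mul Msym.
move=> u; rewrite -mulmxA -[_ 0 0]/(dot u _) -mulmxA -{1}Msym -dot_mull.
exact: dot_ge0.
Qed.

Lemma trmx_horner_mx n (M : 'M[R]_n.+1) (p : {poly R}) :
  (horner_mx M p)^T = horner_mx M^T p.
Proof.
elim/poly_ind: p => [|p c IHp]; first by rewrite !rmorph0 trmx0.
rewrite !rmorphD !rmorphM /= !horner_mx_X !horner_mx_C linearD /=.
rewrite tr_scalar_mx trmx_mul IHp; congr (_ + _).
exact: (comm_mx_horner p (comm_mx_refl M^T)).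
Qed.

Lemma symmx_horner n (M : 'M[R]_n.+1) (p : {poly R}) :
  M \is symmetricmx -> horner_mx M p \is symmetricmx.
Proof. by move=> /symmxP Msym; apply/symmxP; rewrite trmx_horner_mx Msym. Qed.

(** Over [R[i]] the matrix is unitarily diagonalizable with real diagonal [d].
    The rows of the unitary matrix are eigenvectors, so each [d_i] is a root
    of the characteristic polynomial, which has real coefficients: it is an
    eigenvalue over [R] as well.  A polynomial killing every [d_i] kills the
    diagonal matrix, hence [M]. *)
Lemma symmx_spectrum n (M : 'M[R]_n.+1) : M \is symmetricmx ->
  exists2 s : seq R, forall a, (a \in s) = eigenvalue M a
    & forall p : {poly R}, all (root p) s -> horner_mx M p = 0.
Proof.
move=> Msym; pose toC := real_complex R; pose A := map_mx toC M.
have Asym : A \is symmetricmx.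
  apply/is_hermitianmxP; rewrite expr0 scale1r map_mx_id // /A map_trmx.
  by rewrite (symmxP _ Msym).
have Areal : A \is a mxOver Num.real.
  by apply/mxOverP => i j; rewrite mxE; apply/complex_realP; exists (M i j).
have /orthomx_spectralP := symmetric_normalmx Asym Areal.
have := hermitian_spectral_diag_real (realsym_hermsym Asym Areal).
have := spectral_unit A.
set U := spectralmx A; set d := spectral_diag A => Uunit dreal Adiag.
have dRe i : toC (complex.Re (d 0 i)) = d 0 i.
  by rewrite /toC RRe_real //; apply: (mxOverP dreal).
have root_charC x : root (char_poly A) (toC x) = root (char_poly M) x.
  by rewrite -map_char_poly fmorph_root.
pose s := [seq complex.Re (d 0 i) | i : 'I_n.+1].
have s_eigen a : a \in s -> eigenvalue M a.
  move=> /mapP[i _ ->]; rewrite eigenvalue_root_char.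
  rewrite -root_charC dRe -eigenvalue_root_char.
  apply/eigenvalueP; exists (row i U).
    rewrite {1}Adiag -!mulmxA -row_mul !mulmxA mulmxV // mul1mx.
    by rewrite row_mul row_diag_mx -scalemxAl -rowE.
  apply: contraTneq Uunit => Ui0; apply/negP => Uunit.
  have : row i (U *m invmx U) = 0 by rewrite row_mul Ui0 mul0mx.
  rewrite mulmxV // => /rowP/(_ i); rewrite !mxE eqxx => /eqP.
  by rewrite oner_eq0.
have s_kills p : all (root p) s -> horner_mx M p = 0.
  move=> /allP p0; apply: (map_mx_inj (f := toC)).
  rewrite map_mx0 map_horner_mx -/A Adiag horner_mx_uconjC // horner_mx_diag.
  rewrite (_ : map_mx _ d = 0) ?linear0 ?mulmx0 ?mul0mx //.
  apply/rowP => i; rewrite !mxE -dRe horner_map (rootP (p0 _ _)) ?rmorph0 //.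
  by apply: map_f; rewrite mem_enum.
exists s => // a; apply/idP/idP => [|Ma]; first exact: s_eigen.
(* An eigenvalue is a root of the minimal polynomial, which divides the
   product of the ['X - x] over [s]. *)
rewrite -root_prod_XsubC; apply: (root_dvdp (p := mxminpoly M)).
  apply: mxminpoly_min; apply: s_kills; apply/allP => x x_s.
  by rewrite root_prod_XsubC.
by rewrite -eigenvalue_root_min.
Qed.

Lemma poly_interpolation (K : fieldType) (f : K -> K) (s : seq K) :
  exists r : {poly K}, forall x, x \in s -> r.[x] = f x.
Proof.
elim: s => [|a s [r rP]]; first by exists 0.
have [a_s|a_s] := boolP (a \in s).
  by exists r => x; rewrite inE => /predU1P[->|]; apply: rP.
pose w : {poly K} := \prod_(y <- s) ('X - y%:P).
have wa : w.[a] != 0 by rewrite -rootE root_prod_XsubC.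
exists (r + ((f a - r.[a]) / w.[a]) *: w) => x; rewrite !hornerE inE.
move=> /predU1P[->|x_s]; first by rewrite divfK // addrC subrK.
suff /rootP -> : root w x by rewrite mulr0 addr0 rP.
by rewrite root_prod_XsubC.
Qed.

(** [r] interpolates the square root of [p] on the spectrum, where
    [r^2 - p] therefore vanishes.  The root [r] is itself nonnegative there,
    so that the lemma can be applied again to [r]. *)
Lemma symmx_poly_sqrt n (M : 'M[R]_n.+1) (p : {poly R}) :
  M \is symmetricmx -> (forall a, eigenvalue M a -> 0 <= p.[a]) ->
  exists2 r : {poly R}, forall a, eigenvalue M a -> 0 <= r.[a]
    & horner_mx M r *m horner_mx M r = horner_mx M p.
Proof.
move=> Msym p_ge0; have [s sE s_kills] := symmx_spectrum Msym.
have [r rP] := poly_interpolation (fun x => Num.sqrt p.[x]) s.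
exists r => [a Ma|]; first by rewrite rP ?sE // sqrtr_ge0.
apply/eqP; rewrite -subr_eq0 -[_ *m _]rmorphM -rmorphB /= s_kills //.
apply/allP => x x_s; rewrite rootE !hornerE rP // -expr2 sqr_sqrtr ?subrr //.
by rewrite p_ge0 // -sE.
Qed.

Lemma psdmx_horner n (M : 'M[R]_n.+1) (p : {poly R}) :
  M \is symmetricmx -> (forall a, eigenvalue M a -> 0 <= p.[a]) ->
  psdmx (horner_mx M p).
Proof.
move=> Msym /(symmx_poly_sqrt Msym)[r _ <-].
exact/psdmx_sqr/symmx_horner.
Qed.

(** Eigenvectors are row vectors here; symmetry turns them into columns. *)
Lemma symmx_eigenvector n (M : 'M[R]_n) a : M \is symmetricmx ->
  eigenvalue M a -> exists2 u : 'cV[R]_n, u != 0 & M *m u = a *: u.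
Proof.
move=> /symmxP Msym /eigenvalueP[v vM v_neq0]; exists v^T.
  by rewrite -trmx0 (inj_eq trmx_inj).
by rewrite -{1}Msym -trmx_mul vM linearZ.
Qed.

(** * Square roots of psd matrices *)

(** The eigenvalues of a psd [M] are nonnegative, so [M] is [r(M)^2] with [r]
    nonnegative on the spectrum; for that reason [r(M)] is psd too. *)
Lemma psdmx_sqrt_exists n (M : 'M[R]_n) :
  psdmx M -> exists S : 'M[R]_n, psdmx S /\ S *m S = M.
Proof.
case: n M => [|n] M psdM; first by exists M; split=> //; apply/matrixP; case.
have Msym : M \is symmetricmx by case: psdM.
have X_ge0 a : eigenvalue M a -> 0 <= ('X : {poly R}).[a].
  move=> /(symmx_eigenvector Msym)[u u_neq0 Mu].
  by have := psdmx_dot u psdM; rewrite Mu dotZr hornerX pmulr_lge0 ?dot_gt0.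
have [r r_ge0 rr] := symmx_poly_sqrt Msym X_ge0.
exists (horner_mx M r); split; first exact: psdmx_horner.
by rewrite rr horner_mx_X.
Qed.

Lemma sqrtmxP n (M : 'M[R]_n) :
  psdmx M -> psdmx (sqrtmx M) /\ sqrtmx M *m sqrtmx M = M.
Proof.
by move=> /psdmx_sqrt_exists M_sqrt; apply: (xgetPex 0 M_sqrt).
Qed.

(** * Norm and eigenvalues *)

(** The hypothesis says that [c^2 - X^2] is nonnegative on the spectrum, so
    [c^2 - M^2] is psd, i.e. [|M u|^2 <= c^2 |u|^2] for every [u]. *)
Lemma symmx_opnorm_le n (M : 'M[R]_n) c : M \is symmetricmx -> 0 <= c ->
  (forall a, eigenvalue M a -> a ^+ 2 <= c ^+ 2) -> opnorm M <= c.
Proof.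
case: n M => [|n] M Msym c_ge0 Mc; apply: opnorm_le => // u.
  by rewrite !dotE !big_ord0 mulr0.
have : psdmx (horner_mx M ((c ^+ 2)%:P - 'X * 'X)).
  by apply: psdmx_horner => // a /Mc; rewrite !hornerE -expr2 subr_ge0.
move=> /(psdmx_dot u); rewrite rmorphB (rmorphM (horner_mx M)) /=.
rewrite horner_mx_C horner_mx_X mulmxBl mul_scalar_mx dotBr dotZr subr_ge0.
by rewrite dot_mull (symmxP _ Msym) mulmxA.
Qed.

(** For an eigenvector [u] of [A - B], both [<u, (A^2 - B^2) u>] and
    [a <u, u>] are expressed by the nonnegative numbers [x = <u, A u>] and
    [y = <u, B u>]: the former is [a (x + y)] and the latter is [x - y], and
    [|x - y| <= x + y]. *)
Lemma sqr_eigenvalue_le_opnorm n (A B : 'M[R]_n) a : psdmx A -> psdmx B ->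
  eigenvalue (A - B) a -> a ^+ 2 <= opnorm (A *m A - B *m B).
Proof.
move=> psdA psdB; have [/symmxP symA _] := psdA; have [/symmxP symB _] := psdB.
have symAB : A - B \is symmetricmx.
  by apply/symmxP; rewrite linearB /= symA symB.
move=> /(symmx_eigenvector symAB)[u /dot_gt0 u_gt0 ABu].
have := normr_quadform_le (A *m A - B *m B) u.
have := psdmx_dot u psdA; have := psdmx_dot u psdB.
(* [A u = B u + a u], so [<A u, A u> - <B u, B u> = <A u + B u, a u>]. *)
have quadE : dot u ((A *m A - B *m B) *m u)
    = a * (dot u (A *m u) + dot u (B *m u)).
  have Au : A *m u = B *m u + a *: u by rewrite -ABu mulmxBl addrC subrK.
  rewrite mulmxBl dotBr -!mulmxA -{1}symA -{1}symB -!dot_mull Au.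
  rewrite !(dotDr, dotZr, dotC (_ + _)) !(dotC _ u); ring.
have diffE : dot u (A *m u) - dot u (B *m u) = a * dot u u.
  by rewrite -dotBr -mulmxBl ABu dotZr.
rewrite quadE; move: diffE u_gt0; clear.
move: (dot u (A *m u)) (dot u (B *m u)) (dot u u) (opnorm _) => x y z q.
move=> xyz z_gt0 y_ge0 x_ge0 le_q.
rewrite -(ler_pM2r z_gt0); apply: le_trans le_q.
rewrite normrM (ger0_norm (addr_ge0 x_ge0 y_ge0)).
rewrite -[a ^+ 2]real_normK ?num_real // expr2 -mulrA ler_wpM2l //.
by rewrite -[z]gtr0_norm // -normrM -xyz ler_norml; apply/andP; split; lra.
Qed.

End Symmetric.

Theorem lemma2p2 (R : realType) (n : nat) (P Q : 'M[R]_n)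
    (symP : P \is symmetricmx) (symQ : Q \is symmetricmx)
    (psdP : psdmx P) (psdPQ : psdmx (P + Q)) :
  opnorm (sqrtmx (P + Q) - sqrtmx P) <= 3 * Num.sqrt (opnorm Q).
Proof.
have [psdA sqrA] := sqrtmxP psdPQ; have [psdB sqrB] := sqrtmxP psdP.
have le_sqrt : opnorm (sqrtmx (P + Q) - sqrtmx P) <= Num.sqrt (opnorm Q).
  apply: symmx_opnorm_le; rewrite ?sqrtr_ge0 //.
    have [/symmxP symA _] := psdA; have [/symmxP symB _] := psdB.
    by apply/symmxP; rewrite linearB /= symA symB.
  move=> a /(sqr_eigenvalue_le_opnorm psdA psdB).
  by rewrite sqrA sqrB addrC addKr sqr_sqrtr ?opnorm_ge0.
by apply: le_trans le_sqrt _; rewrite ler_peMl ?sqrtr_ge0 // ler1n.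
Qed.
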